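(* Let $S(t)\in\mathbb C[t]$ be a polynomial of degree $m$, let $q_0$ be a nonzero complex number, and let $Q(t)\in\mathbb C[[t]]$ be the formal power series solution with $Q(0)=q_0$ of $$(tQ''(t)+Q'(t))Q(t)-t(Q'(t))^2=S(t)Q(t),$$ namely $Q(t)=q_0+\sum_{i\ge1}f_S^i(q_0^{-1})t^i$. Then $Q(t)$ is a polynomial in $t$ if and only if there exists $N\in\mathbb N$ with $N\ge m+2$ such that $q_0^{-1}$ is a common root of the polynomials $\{f_S^i: N+1\le i\le 2N-1\}$.
   Context: For $S(t)=\sum_{i\ge0}s_it^i$ (with $s_i=0$ for $i>\deg S$), the polynomials $f_S^i(t)\in\mathbb C[t]$, $i\ge1$, are defined recursively by $f_S^1(t)=s_0$ and, for $k\ge1$, $$f_S^{k+1}(t)=\frac{s_k}{(k+1)^2}+\frac{t}{(k+1)^2}\sum_{i=0}^{k-1}\bigl(s_i-(i+1)(2i+1-k)f_S^{i+1}(t)\bigr)f_S^{k-i}(t).$$ *)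

(* Defs.v *)
From HB Require Import structures.
From mathcomp Require Import all_boot all_order all_algebra.
From mathcomp Require Import boolp functions reals.
From mathcomp Require Export complex.

Set Implicit Arguments.
Unset Strict Implicit.
Unset Printing Implicit Defensive.

Import GRing.Theory.
Local Open Scope ring_scope.

(* Formal power series over R: [Q : fps R] is its sequence of coefficients,
   [Q i] being the coefficient of t^i.  The alias matters: addition is inherited
   from the function space [nat -> R], but the product is the Cauchy product,
   not the pointwise product that the library puts on [nat -> R]. *)
Definition fps (R : comNzRingType) : Type := nat -> R.

Section FormalPowerSeries.
Variable R : comNzRingType.
Implicit Types (P Q : fps R) (p : {poly R}).

HB.instance Definition _ := GRing.Zmodule.copy (fps R) (nat -> R).

Definition fps_of_poly p : fps R := fun n => p`_n.

Definition fps_one : fps R := fps_of_poly 1.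

Definition fps_mul P Q : fps R := fun n => \sum_(i < n.+1) P i * Q (n - i)%N.

Let trunc n P : {poly R} := \poly_(i < n.+1) P i.

Let fps_mul_trunc n k P Q : (k <= n)%N ->
  fps_mul P Q k = (trunc n P * trunc n Q)`_k.
Proof.
move=> kn; rewrite coefM /fps_mul; apply: eq_bigr => i _.
rewrite !coef_poly !ltnS (leq_trans _ kn) ?(leq_trans _ kn) ?leq_subr //.
by rewrite -ltnS.
Qed.

Let trunc_mul n k P p Q : (k <= n)%N ->
  (forall j, (j <= n)%N -> P j = p`_j) ->
  fps_mul P Q k = (p * trunc n Q)`_k.
Proof.
move=> kn Pp; rewrite coefM /fps_mul; apply: eq_bigr => i _.
have ik : (i <= k)%N by rewrite -ltnS.
by rewrite Pp ?(leq_trans ik) // coef_poly ltnS (leq_trans (leq_subr _ _) kn).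
Qed.

Lemma fps_mulC : commutative fps_mul.
Proof.
by move=> P Q; apply/funext => n; rewrite !(fps_mul_trunc _ _ (leqnn n)) mulrC.
Qed.

Lemma fps_mulA : associative fps_mul.
Proof.
move=> P Q T; apply/funext => n; rewrite [LHS](_ : _ = fps_mul (fps_mul Q T) P n);
  last by rewrite fps_mulC.
rewrite (trunc_mul P (leqnn n) (fun j jn => fps_mul_trunc Q T jn)).
rewrite (trunc_mul T (leqnn n) (fun j jn => fps_mul_trunc P Q jn)).
by rewrite [in LHS]mulrC mulrA.
Qed.

Lemma fps_mul1 : left_id fps_one fps_mul.
Proof.
move=> P; apply/funext => n.
rewrite (trunc_mul P (leqnn n) (p := 1)) // mul1r coef_poly ltnSn //.
Qed.

Lemma fps_mulDl : left_distributive fps_mul +%R.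
Proof.
move=> P Q T; apply/funext => n.
transitivity (fps_mul P T n + fps_mul Q T n) => //.
by rewrite /fps_mul -big_split /=; apply: eq_bigr => i _; rewrite -mulrDl.
Qed.

Lemma fps_one_neq0 : fps_one != 0.
Proof.
apply/eqP => /(congr1 (fun P : fps R => P 0%N)).
rewrite /fps_one /fps_of_poly coef1 => /eqP.
by rewrite (_ : (0 : fps R) 0%N = 0) // oner_eq0.
Qed.

HB.instance Definition _ := GRing.Zmodule_isComNzRing.Build (fps R)
  fps_mulA fps_mulC fps_mul1 fps_mulDl fps_one_neq0.

Definition fps_deriv Q : fps R := fun n => Q n.+1 *+ n.+1.

Definition is_polynomial Q : Prop := exists p : {poly R}, Q = fps_of_poly p.

(* (t Q'' + Q') Q - t (Q')^2 = S Q  in  R[[t]] *)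
Definition solves_ode (S : {poly R}) Q : Prop :=
  let t := fps_of_poly 'X in
  let Q' := fps_deriv Q in
  let Q'' := fps_deriv Q' in
  (t * Q'' + Q') * Q - t * Q' ^+ 2 = fps_of_poly S * Q.

End FormalPowerSeries.

Section Recursion.
Variables (F : fieldType) (S : {poly F}).

(* The right-hand side of the recursion giving f^{k+1} from f = (f^1, ..., f^k);
   [2i+1-k] is computed in F, as it may be negative. *)
Definition fS_step (f : nat -> {poly F}) (k : nat) : {poly F} :=
  (S`_k / (k.+1%:R ^+ 2))%:P
  + (k.+1%:R ^- 2) *:
    ('X * \sum_(i < k)
       ((S`_i)%:P - (i.+1%:R * ((2 * i + 1)%:R - k%:R)) *: f i.+1) * f (k - i)%N).

(* [fS_table n i] is f_S^i for 1 <= i <= n, and the junk value 0 otherwise. *)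
Fixpoint fS_table (n : nat) : nat -> {poly F} :=
  match n with
  | 0 => fun=> 0
  | 1 => fun i => if i == 1%N then (S`_0)%:P else 0
  | k.+1 => fun i => if i == k.+1 then fS_step (fS_table k) k else fS_table k i
  end.

Definition fS (i : nat) : {poly F} := fS_table i i.

Lemma fS1 : fS 1 = (S`_0)%:P.
Proof. by []. Qed.

Let fS_tableE n i : (0 < i <= n)%N -> fS_table n i = fS i.
Proof.
elim: n => [|n IHn]; first by case: i.
rewrite [(i <= _)%N]leq_eqVlt ltnS => /andP[i0 /orP[/eqP -> //|lein]].
case: n IHn lein => [|n] IHn lein; first by move: i0; rewrite ltnNge lein.
rewrite -IHn ?i0 // [LHS]/= (_ : (i == n.+2) = false) //.
by apply/eqP => ein; move: lein; rewrite ein ltnn.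
Qed.

Lemma fS_rec (k : nat) : (1 <= k)%N ->
  fS k.+1 = (S`_k / (k.+1%:R ^+ 2))%:P
    + (k.+1%:R ^- 2) *:
      ('X * \sum_(i < k)
         ((S`_i)%:P - (i.+1%:R * ((2 * i + 1)%:R - k%:R)) *: fS i.+1)
           * fS (k - i)%N).
Proof.
case: k => // k _; rewrite {1}/fS [LHS]/= eqxx /fS_step.
congr (_ + _ *: ('X * _)); apply: eq_bigr => i _.
by rewrite -!/(fS_table k.+1 _) !fS_tableE ?subn_gt0 ?leq_subr ?ltn_ord.
Qed.

(* q0 + \sum_(i >= 1) f_S^i(q0^-1) t^i *)
Definition fS_series (q0 : F) : fps F :=
  fun i => if i == 0%N then q0 else (fS i).[q0^-1].

End Recursion.

(* Main.v *)
Require Import Defs.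
From mathcomp Require Import all_boot all_order all_algebra.
From mathcomp Require Import reals complex.
From mathcomp Require Import boolp ring zify.

(** Comparing coefficients of t^n turns the differential equation into a
    recursion that expresses a_(n+1) through a_0, ..., a_n; at t = 1 / q0 the
    f_S^i satisfy the same recursion.  If a_i = 0 for N < i < 2N, then each
    product a_(i+1) a_(n-i) in the recursion for a_(n+1), n + 1 >= 2N, has a
    factor with index > N, except a_N a_N when n + 1 = 2N, and this one has
    coefficient 2N - (n + 1) = 0.  The terms s_i a_(n-i) vanish because i <= m
    forces n - i > N.  Hence a_i = 0 for all i > N by induction. *)

Import GRing.Theory Num.Theory.

Local Open Scope ring_scope.
Local Open Scope complex_scope.

Section Coefficients.
Variable R : comNzRingType.
Implicit Types (P Q : fps R) (S : {poly R}).

Lemma fps_mulE P Q n : (P * Q) n = \sum_(i < n.+1) P i * Q (n - i)%N.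
Proof. by []. Qed.

Lemma fps_mulX Q n : (fps_of_poly 'X * Q) n = if n is k.+1 then Q k else 0.
Proof.
rewrite fps_mulE; under eq_bigr do rewrite /fps_of_poly coefX.
case: n => [|n]; first by rewrite big_ord1 mul0r.
rewrite !big_ord_recl mul0r add0r mul1r subn1 big1 ?addr0 // => i _.
by rewrite mul0r.
Qed.

(** The coefficient of t^i in tQ'' + Q' is (i+1)^2 a_(i+1), that of t^(n-i) in tQ' is (n-i) a_(n-i),
    and (i+1)^2 - (i+1)(n-i) = (i+1)(2i+1-n). *)
Lemma solves_odeE S Q : solves_ode S Q <-> forall n : nat,
  \sum_(i < n.+1) (i.+1%:R * ((2 * i + 1)%:R - n%:R)) * Q i.+1 * Q (n - i)%N =
  \sum_(i < n.+1) S`_i * Q (n - i)%N.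
Proof.
have lhsE n :
    ((fps_of_poly 'X * fps_deriv (fps_deriv Q) + fps_deriv Q) * Q
      - fps_of_poly 'X * fps_deriv Q ^+ 2) n =
    \sum_(i < n.+1) (i.+1%:R * ((2 * i + 1)%:R - n%:R)) * Q i.+1 * Q (n - i)%N.
  (* Writing t Q'^2 as Q' (t Q') makes both sums run over the products [Q i.+1 * Q (n - i)]. *)
  rewrite expr2 mulrCA.
  transitivity (\sum_(i < n.+1)
      ((fps_of_poly 'X * fps_deriv (fps_deriv Q)) i + fps_deriv Q i) * Q (n - i)%N
    - \sum_(i < n.+1)
      fps_deriv Q i * (fps_of_poly 'X * fps_deriv Q) (n - i)%N) => //.
  rewrite -sumrB; apply: eq_bigr => -[i /= lin] _.
  have -> : (fps_of_poly 'X * fps_deriv Q) (n - i)%N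
            = (n%:R - i%:R) * Q (n - i)%N.
    rewrite -natrB // fps_mulX /fps_deriv.
    by case: (n - i)%N => [|k]; rewrite ?mul0r // mulr_natl.
  have -> : (fps_of_poly 'X * fps_deriv (fps_deriv Q)) i
            = i%:R * i.+1%:R * Q i.+1.
    rewrite fps_mulX /fps_deriv.
    by case: i {lin} => [|k]; rewrite ?mul0r // -mulrA !mulr_natl.
  rewrite /fps_deriv -mulr_natl [(2 * i + 1)%:R]natrD natrM -natr1; ring.
split=> [ode n|coefs]; first by rewrite -lhsE ode.
by apply/funext => n; rewrite lhsE coefs.
Qed.

Lemma is_polynomial_bounded Q :
  is_polynomial Q <-> exists N, forall i, (N < i)%N -> Q i = 0.
Proof.
split=> [[p ->]|[N QN]].
  by exists (size p) => i pi; rewrite /fps_of_poly nth_default // ltnW.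
exists (\poly_(i < N.+1) Q i); apply/funext => i.
by rewrite /fps_of_poly coef_poly; case: ltnP => // /QN.
Qed.

End Coefficients.

Section Recursion.
Variable F : fieldType.
Hypothesis pcharF0 : [pchar F] =i pred0.
Implicit Types (Q : fps F) (S : {poly F}).

(** The f_S recursion with 1 / a_0 in place of t and a_i in place of f_S^i; it reads only a_0, ...,
    a_n. *)
Definition ode_step S Q (n : nat) : F :=
  S`_n / n.+1%:R ^+ 2 + (n.+1%:R ^- 2) * ((Q 0%N)^-1 * \sum_(i < n)
    (S`_i - (i.+1%:R * ((2 * i + 1)%:R - n%:R)) * Q i.+1) * Q (n - i)%N).

(** The term i = n on the left of [solves_odeE] is (n+1)^2 a_(n+1) a_0. In characteristic 0 the
    factor (n+1)^2 a_0 is invertible, so the equation can be solved for a_(n+1). *)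
Lemma solves_ode_rec S Q : Q 0%N != 0 ->
  solves_ode S Q <-> forall n, Q n.+1 = ode_step S Q n.
Proof.
move=> Q0; rewrite solves_odeE.
have eqv n : (\sum_(i < n.+1)
      (i.+1%:R * ((2 * i + 1)%:R - n%:R)) * Q i.+1 * Q (n - i)%N
    = \sum_(i < n.+1) S`_i * Q (n - i)%N) <-> Q n.+1 = ode_step S Q n.
  have n0 : n.+1%:R != 0 :> F by rewrite ((pcharf0P F).1 pcharF0).
  rewrite /ode_step !big_ord_recr /= subnn.
  under [in X in _ <-> X]eq_bigr do rewrite mulrBl.
  rewrite sumrB.
  set A := \sum_(i < n) _ * Q i.+1 * _; set B := \sum_(i < n) _.
  have -> : (2 * n + 1)%:R - n%:R = n.+1%:R :> F.
    by rewrite natrD natrM -natr1; ring.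
  move: n.+1%:R n0 => N n0.
  split=> [e|->]; last by field; rewrite Q0 n0.
  have -> : B - A = N * N * Q n.+1 * Q 0%N - S`_n * Q 0%N.
    by rewrite -[B](addrK (S`_n * Q 0%N)) -e; ring.
  by field; rewrite Q0 n0.
by split=> h n; apply/eqv.
Qed.

(** Strong induction applies because step n reads only indices up to n. *)
Lemma ode_step_unique S Q T : Q 0%N = T 0%N ->
  (forall n, Q n.+1 = ode_step S Q n) -> (forall n, T n.+1 = ode_step S T n) ->
  Q = T.
Proof.
move=> QT0 Qrec Trec; apply/funext => n.
elim/ltn_ind: n => -[//|n] IHn; rewrite Qrec Trec /ode_step QT0.
congr (_ + _ * (_ * _)); apply: eq_bigr => i _.
by rewrite !IHn // ltnS ?leq_subr.
Qed.

Lemma fS_series_rec S (q0 : F) n :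
  fS_series S q0 n.+1 = ode_step S (fS_series S q0) n.
Proof.
case: n => [|n].
  rewrite /ode_step big_ord0 !mulr0 addr0 expr1n divr1.
  by rewrite /fS_series /= fS1 hornerC.
rewrite /ode_step {1}/fS_series /= fS_rec //.
rewrite hornerD hornerC hornerZ hornerM hornerX horner_sum.
congr (_ + _ * (_ * _)); apply: eq_bigr => i _.
rewrite hornerM hornerD hornerN hornerZ hornerC /fS_series /=.
(* Since i < n + 1, the index n + 1 - i is nonzero and the series takes its [fS] branch, not q0. *)
by rewrite subn_eq0 leqNgt ltn_ord.
Qed.

Lemma fS_series_solves S (q0 : F) Q : q0 != 0 ->
  (solves_ode S Q /\ Q 0%N = q0) <-> Q = fS_series S q0.
Proof.
move=> q0n0; split=> [[ode Q0]|->].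
  apply: (@ode_step_unique S) => //; last exact: fS_series_rec.
  by apply/solves_ode_rec; rewrite ?Q0.
by split=> //; apply/solves_ode_rec => //; apply: fS_series_rec.
Qed.

Lemma ode_gap_vanish S Q N : ((size S).-1 + 2 <= N)%N ->
  (forall n, Q n.+1 = ode_step S Q n) ->
  (forall i, (N < i < 2 * N)%N -> Q i = 0) ->
  forall i, (N < i)%N -> Q i = 0.
Proof.
move=> SN Qrec gap; elim/ltn_ind => -[//|n] IHn Nn.
have [nlt|nge] := ltnP n.+1 (2 * N); first by apply: gap; rewrite Nn.
have Sz k : ((size S).-1 < k)%N -> S`_k = 0.
  by move=> lt_k; rewrite nth_default ?(leq_trans (leqSpred _) lt_k).
rewrite Qrec /ode_step Sz ?mul0r ?add0r; last by lia.
rewrite big1 ?mulr0 // => -[i /= lin] _.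
have [niN|niN] := ltnP N (n - i); first by rewrite (IHn (n - i)%N) ?mulr0 //; lia.
(* From n - i <= N and 2N <= n + 1 follows i >= N - 1 > m. *)
rewrite Sz ?sub0r; last by lia.
have [iN|iN] := ltnP N i.+1; first by rewrite (IHn i.+1) ?mulr0 ?oppr0 ?mul0r //; lia.
(* Both indices are now at most N and sum to n + 1 >= 2N, so i + 1 = n - i = N. *)
have -> : (2 * i + 1 = n)%N by lia.
by rewrite subrr mulr0 mul0r oppr0 mul0r.
Qed.

End Recursion.

Theorem proposition2p2 (R : realType) (S : {poly R[i]}) (m : nat)
    (hm : (size S).-1 = m) (q0 : R[i]) (hq0 : q0 != 0) :
  (forall Q : fps R[i],
     (solves_ode S Q /\ Q 0%N = q0) <-> Q = fS_series S q0) /\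
  (forall Q : fps R[i],
     solves_ode S Q -> Q 0%N = q0 ->
     (is_polynomial Q <->
      exists N : nat, (m + 2 <= N)%N /\
        forall i : nat, (N + 1 <= i <= 2 * N - 1)%N -> root (fS S i) q0^-1)).
Proof.
have C0 : [pchar R[i]] =i pred0 by apply: pchar_num.
split=> [Q|Q ode Q0]; first exact: fS_series_solves.
have QE : Q = fS_series S q0 by apply/fS_series_solves.
rewrite is_polynomial_bounded; split=> [[N QN]|[N [mN rootN]]].
  (* The maximum secures the bound m + 2, and all coefficients beyond it still vanish. *)
  exists (maxn N (m + 2)); split=> [|i iN]; first exact: leq_maxr.
  have := QN i; rewrite QE /fS_series; case: i iN => [|i] iN; first by lia.
  by move=> fi; apply/rootP/fi; lia.
exists N; apply: (@ode_gap_vanish _ S); rewrite ?hm //.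
  by rewrite QE; apply: fS_series_rec.
move=> i iN; rewrite QE /fS_series; case: i iN => [|i] iN; first by lia.
by apply/rootP/rootN; lia.
Qed.
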